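(* Let $n\ge2$ and let $C\subset\mathbb{R}^n$ be a circle (of positive radius, lying in some two-dimensional affine plane) equipped with an orientation. Let $p_0\ne p_1$ be points of $C$ and let $v_0,v_1\in S^{n-1}$ be the unit tangent vectors of $C$ at $p_0,p_1$ compatible with the orientation. Let $A$ be the arc of $C$ that starts at $p_0$, goes in the direction $v_0$ (i.e. follows the orientation) and ends at $p_1$. Then $B_{1/2}\left((p_0,v_0),(p_1,v_1)\right)=(p_{1/2},v_{1/2})$, where $p_{1/2}$ is the mid-point of the arc $A$ and $v_{1/2}$ is the unit tangent vector of $C$ at $p_{1/2}$ compatible with the orientation.
   Context: $\mathbb{R}^n$ carries the Euclidean inner product $\langle\cdot,\cdot\rangle$ and norm $\|\cdot\|$; $S^{n-1}$ is the unit sphere. For $(p_0,v_0),(p_1,v_1)\in\mathbb{R}^n\times S^{n-1}$ with $p_0\ne p_1$ put $u=\frac{p_1-p_0}{\|p_1-p_0\|}$ and $\theta_j=\arccos\langle v_j,u\rangle\in[0,\pi]$, $j=0,1$. Bézier average (for $p_0\ne p_1$ and $\theta_0+\theta_1<2\pi$): put $\alpha=\dfrac{\|p_1-p_0\|}{3\cos^2\left(\frac{\theta_0+\theta_1}{4}\right)}$, and let $b(t)$, $t\in[0,1]$, be the cubic Bézier curve with control points $p_0,\ p_0+\alpha v_0,\ p_1-\alpha v_1,\ p_1$, i.e. $$b(t)=(1-t)^3p_0+3t(1-t)^2(p_0+\alpha v_0)+3t^2(1-t)(p_1-\alpha v_1)+t^3p_1.$$ For $\omega\in[0,1]$, $B_\omega\left((p_0,v_0),(p_1,v_1)\right)=(p_\omega,v_\omega)$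 with $p_\omega=b(\omega)$ and $v_\omega=\frac{b'(\omega)}{\|b'(\omega)\|}$ if $b'(\omega)\ne0$, $v_\omega=0$ if $b'(\omega)=0$. *)

(* Defs.v *)
From HB Require Import structures.
From mathcomp Require Import all_boot all_order all_algebra.
From mathcomp Require Import all_classical all_reals all_analysis.
Import Order.TTheory GRing.Theory Num.Theory.
Import numFieldNormedType.Exports.

Set Implicit Arguments.
Unset Strict Implicit.
Unset Printing Implicit Defensive.

Local Open Scope classical_set_scope.
Local Open Scope ring_scope.

Definition dot (R : realType) (n : nat) (u v : 'rV[R]_n) : R :=
  \sum_(i < n) u ord0 i * v ord0 i.

(* The library norm `|u| on row vectors is the sup norm; it is used only through
   the topology underlying derivatives, never as a length. *)
Definition enorm (R : realType) (n : nat) (u : 'rV[R]_n) : R :=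
  Num.sqrt (dot u u).

(* normalize 0 = 0 since 0^-1 = 0. *)
Definition normalize (R : realType) (n : nat) (u : 'rV[R]_n) : 'rV[R]_n :=
  (enorm u)^-1 *: u.

Definition chord_angle (R : realType) (n : nat) (p0 p1 v : 'rV[R]_n) : R :=
  acos (dot v (normalize (p1 - p0))).

Definition bezier_admissible (R : realType) (n : nat)
    (x0 x1 : 'rV[R]_n * 'rV[R]_n) : Prop :=
  [/\ enorm x0.2 = 1, enorm x1.2 = 1, x0.1 <> x1.1 &
      chord_angle x0.1 x1.1 x0.2 + chord_angle x0.1 x1.1 x1.2 < 2 * pi].

Definition bezier_alpha (R : realType) (n : nat)
    (x0 x1 : 'rV[R]_n * 'rV[R]_n) : R :=
  enorm (x1.1 - x0.1) /
    (3 * cos ((chord_angle x0.1 x1.1 x0.2 + chord_angle x0.1 x1.1 x1.2) / 4)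
         ^+ 2).

Definition bezier_curve (R : realType) (n : nat)
    (x0 x1 : 'rV[R]_n * 'rV[R]_n) (t : R) : 'rV[R]_n :=
  let a := bezier_alpha x0 x1 in
  (1 - t) ^+ 3 *: x0.1
  + (3 * t * (1 - t) ^+ 2) *: (x0.1 + a *: x0.2)
  + (3 * t ^+ 2 * (1 - t)) *: (x1.1 - a *: x1.2)
  + t ^+ 3 *: x1.1.

(* Meaningful when bezier_admissible x0 x1 and 0 <= w <= 1. *)
Definition bezier_average (R : realType) (n : nat) (w : R)
    (x0 x1 : 'rV[R]_n * 'rV[R]_n) : 'rV[R]_n * 'rV[R]_n :=
  let b := bezier_curve x0 x1 in
  let b' := derive1 b w in
  (b w, if b' != 0 then normalize b' else 0).

(* An orientation of a circle is an orientation of its plane, given here by an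
   ordered orthonormal basis (e1, e2) of the plane's direction space: the circle
   is travelled from e1 towards e2. *)
Record oriented_circle (R : realType) (n : nat) := OrientedCircle {
  center : 'rV[R]_n;
  radius : R;
  axis1 : 'rV[R]_n;
  axis2 : 'rV[R]_n;
  radius_gt0 : 0 < radius;
  axis1_unit : enorm axis1 = 1;
  axis2_unit : enorm axis2 = 1;
  axes_orthogonal : dot axis1 axis2 = 0
}.

Definition circle_points (R : realType) (n : nat) (C : oriented_circle R n) :
    set 'rV[R]_n :=
  [set p | (exists x y : R, p = center C + x *: axis1 C + y *: axis2 C) /\
           enorm (p - center C) = radius C].

Definition circle_curve (R : realType) (n : nat) (C : oriented_circle R n)
    (s : R) : 'rV[R]_n :=
  center C + radius C *: (cos s *: axis1 C + sin s *: axis2 C).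

Definition circle_tangent (R : realType) (n : nat) (C : oriented_circle R n)
    (p v : 'rV[R]_n) : Prop :=
  exists s : R,
    p = circle_curve C s /\ v = normalize (derive1 (circle_curve C) s).

(* The arc of C from p0 to p1 along the orientation is the image of [s0, s1]
   under circle_curve C. For p0 <> p1 the pair (s0, s1) exists and is unique up
   to a common shift by a multiple of 2 * pi. *)
Definition arc_parameters (R : realType) (n : nat) (C : oriented_circle R n)
    (p0 p1 : 'rV[R]_n) (s0 s1 : R) : Prop :=
  [/\ p0 = circle_curve C s0, p1 = circle_curve C s1 & s0 < s1 < s0 + 2 * pi].

Definition arc_length (R : realType) (n : nat) (C : oriented_circle R n)
    (s0 s1 : R) : R :=
  radius C * (s1 - s0).

Definition arc_midpoint (R : realType) (n : nat) (C : oriented_circle R n)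
    (p0 p1 m : 'rV[R]_n) : Prop :=
  exists s0 s s1 : R,
    [/\ arc_parameters C p0 p1 s0 s1, s0 <= s <= s1, m = circle_curve C s &
        arc_length C s0 s = arc_length C s s1].

(* Main.v *)
Require Import Defs.
From HB Require Import structures.
From mathcomp Require Import all_boot all_order all_algebra.
From mathcomp Require Import all_classical all_reals all_analysis.
From mathcomp Require Import ring lra.
Import Order.TTheory GRing.Theory Num.Theory.
Import numFieldNormedType.Exports.
Local Open Scope classical_set_scope.
Local Open Scope ring_scope.

(** Cut the arc at its parameter midpoint [m] and let [h], with [0 < h < pi],
be half of its angle, so that [p0] and [p1] sit at parameters [m - h] and
[m + h].  Everything happens in the orthonormal frame [(N, T)] formed by the
radial and the tangent unit vector at [m], about which the configuration is
symmetric: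
- [p1 - p0 = (2 r sin h) T], and both [v0] and [v1] make the angle [h] with [T]
  ([circle_chord], [circle_chord_angles]).  The two angles add up to
  [2 h < 2 pi], which is admissibility;
- hence the handle length is [alpha = 2 r sin h / (3 cos^2 (h/2))], that is
  [(4/3) r tan (h/2)] ([circle_bezier_alpha]);
- [b(1/2) = (p0 + p1)/2 + (3/8) alpha (v0 - v1)].  The [T] components cancel and
  the coefficient of [N] is [r cos h + (3/4) alpha sin h
  = r (cos h + 2 sin^2 (h/2)) = r], so [b(1/2)] is the point of the circle at
  parameter [m];
- [b'(1/2) = (3/2)(p1 - p0) - (3/4) alpha (v0 + v1)].  The [N] components cancel
  and the coefficient of [T] is [2 r tan (h/2) (1 + cos^2 (h/2))], which is
  positive, so that [b'(1/2)] normalizes to [T].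
The last two points are [circle_bezier_average].  What remains is to choose
parameters of [p0] and [p1] that are less than one turn apart and in the right
order, which is a shift by a multiple of [2 pi] ([exists_turn_shift]). *)

(** * The Euclidean inner product *)

Lemma dotC {R : realType} {n : nat} (u v : 'rV[R]_n) : dot u v = dot v u.
Proof. by apply: eq_bigr => i _; rewrite mulrC. Qed.

Lemma dotDl {R : realType} {n : nat} (u v w : 'rV[R]_n) :
  dot (u + v) w = dot u w + dot v w.
Proof. by rewrite -big_split; apply: eq_bigr => i _; rewrite mxE mulrDl. Qed.

Lemma dotZl {R : realType} {n : nat} (a : R) (u v : 'rV[R]_n) :
  dot (a *: u) v = a * dot u v.
Proof. by rewrite /dot mulr_sumr; apply: eq_bigr => i _; rewrite mxE mulrA. Qed.

Lemma dotDr {R : realType} {n : nat} (u v w : 'rV[R]_n) :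
  dot u (v + w) = dot u v + dot u w.
Proof. by rewrite ![dot u _]dotC dotDl. Qed.

Lemma dotZr {R : realType} {n : nat} (a : R) (u v : 'rV[R]_n) :
  dot u (a *: v) = a * dot u v.
Proof. by rewrite ![dot u _]dotC dotZl. Qed.

Lemma enorm1_dot {R : realType} {n : nat} {u : 'rV[R]_n} :
  enorm u = 1 -> dot u u = 1.
Proof.
move=> u1; have u2 : Num.sqrt (dot u u) ^+ 2 = 1 by rewrite -/(enorm u) u1 expr1n.
by rewrite -u2 sqr_sqrtr // sumr_ge0 // => i _; rewrite -expr2 sqr_ge0.
Qed.

Lemma enormZ_unit {R : realType} {n : nat} {a : R} {u : 'rV[R]_n} :
  0 < a -> dot u u = 1 -> enorm (a *: u) = a.
Proof.
by move=> a0 uu; rewrite /enorm dotZl dotZr uu mulr1 -expr2 sqrtr_sqr gtr0_norm.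
Qed.

Lemma normalizeZ_unit {R : realType} {n : nat} {a : R} {u : 'rV[R]_n} :
  0 < a -> dot u u = 1 -> normalize (a *: u) = u.
Proof.
by move=> a0 uu; rewrite /normalize enormZ_unit // scalerA mulVf ?scale1r ?gt_eqF.
Qed.

(** * Curves with fixed vector coefficients *)

(** Both the circle and the Bezier cubic are sums of terms [f t *: v] with a
scalar function [f] and a constant vector [v]; this reduces their derivatives
to scalar ones. *)
Lemma is_derive_scalev {R : realType} {V : normedModType R} (v : V) {f : R -> R}
    {t df : R} :
  is_derive t 1 f df -> is_derive t 1 (fun x => f x *: v) (df *: v).
Proof.
move=> [fd fE].
have cv : h^-1 *: (f (h *: 1 + t) *: v - f t *: v) @[h --> 0^'] --> df *: v.
  have -> : (fun h : R => h^-1 *: (f (h *: 1 + t) *: v - f t *: v)) =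
            (fun h : R => (h^-1 *: (f (h *: 1 + t) - f t)) *: v).
    by apply/funext => h; rewrite -scalerBl scalerA.
  by apply: cvgZr_tmp; rewrite -fE; exact: fd.
by apply: DeriveDef; [apply/cvg_ex; exists (df *: v) | exact/cvg_lim].
Qed.

(** * The moving frame of a circle *)

Definition radial {R : realType} {n : nat} (C : oriented_circle R n) (s : R) :=
  cos s *: axis1 C + sin s *: axis2 C.

Definition tangent {R : realType} {n : nat} (C : oriented_circle R n) (s : R) :=
  (- sin s) *: axis1 C + cos s *: axis2 C.

Lemma frame_orthonormal {R : realType} {n : nat} (C : oriented_circle R n)
    (s : R) :
  [/\ dot (radial C s) (radial C s) = 1, dot (tangent C s) (tangent C s) = 1 &
      dot (radial C s) (tangent C s) = 0].
Proof.
have e11 := enorm1_dot (axis1_unit C).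
have e22 := enorm1_dot (axis2_unit C).
have e12 := axes_orthogonal C.
have e21 : dot (axis2 C) (axis1 C) = 0 by rewrite dotC.
have cs := cos2Dsin2 s.
by split; rewrite !(dotDl, dotDr, dotZl, dotZr) e11 e22 e12 e21; lra.
Qed.

(** Turning by [h] rotates the frame: the addition formulas in vector form.  This
is what allows all later computations to refer to the frame at the midpoint
only. *)
Lemma radialD {R : realType} {n : nat} (C : oriented_circle R n) (m h : R) :
  radial C (m + h) = cos h *: radial C m + sin h *: tangent C m.
Proof. by apply/rowP => i; rewrite !mxE cosD sinD; ring. Qed.

Lemma tangentD {R : realType} {n : nat} (C : oriented_circle R n) (m h : R) :
  tangent C (m + h) = cos h *: tangent C m - sin h *: radial C m.
Proof. by apply/rowP => i; rewrite !mxE cosD sinD; ring. Qed.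

Lemma derive1_circle_curve {R : realType} {n : nat} (C : oriented_circle R n)
    (s : R) :
  derive1 (circle_curve C) s = Defs.radius C *: tangent C s.
Proof.
have d1 : is_derive s 1 (fun t => Defs.radius C * cos t)
    (Defs.radius C * - sin s) by exact: is_deriveZ.
have d2 : is_derive s 1 (fun t => Defs.radius C * sin t)
    (Defs.radius C * cos s) by exact: is_deriveZ.
have e1 := is_derive_scalev (axis1 C) d1.
have e2 := is_derive_scalev (axis2 C) d2.
have dC := is_deriveD (is_derive_cst (Defs.center C) s 1) (is_deriveD e1 e2).
rewrite derive1E; have -> : circle_curve C = (cst (Defs.center C) : R -> 'rV[R]_n) +
    ((fun t : R => (Defs.radius C * cos t) *: axis1 C) +
     (fun t : R => (Defs.radius C * sin t) *: axis2 C)).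
  by apply/funext => t; rewrite /circle_curve scalerDr !scalerA.
by rewrite (@derive_val _ _ _ _ _ _ _ dC) add0r scalerDr !scalerA.
Qed.

Lemma normalize_derive1_circle_curve {R : realType} {n : nat}
    (C : oriented_circle R n) (s : R) :
  normalize (derive1 (circle_curve C) s) = tangent C s.
Proof.
rewrite derive1_circle_curve normalizeZ_unit ?radius_gt0 //.
by have [] := frame_orthonormal C s.
Qed.

(** * Parameters modulo a full turn *)

Lemma cos_sinDz {R : realType} (s : R) (k : int) :
  cos (s + k%:~R * (2 * pi)) = cos s /\ sin (s + k%:~R * (2 * pi)) = sin s.
Proof.
have pos (a : R) (j : nat) :
    cos (a + j%:R * (2 * pi)) = cos a /\ sin (a + j%:R * (2 * pi)) = sin a.
  rewrite !mulr_natl.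
  by rewrite (periodicn (@cosD2pi R)) (periodicn (@sinD2pi R)).
case: k => j; first exact: pos.
have [] := pos (s + (Negz j)%:~R * (2 * pi)) j.+1.
by rewrite NegzE mulrNz mulNr subrK.
Qed.

Lemma exists_turn_shift {R : realType} (s0 s1 : R) :
  exists k : int, s0 <= s1 + k%:~R * (2 * pi) < s0 + 2 * pi.
Proof.
have pi0 : 0 < 2 * pi :> R by rewrite mulr_gt0 ?pi_gt0.
set x := (s1 - s0) / (2 * pi); exists (- Num.floor x).
have xE : s1 - s0 = x * (2 * pi) by rewrite mulfVK ?gt_eqF.
have /andP[fx xf] := floor_itv x.
rewrite mulrNz; set f := _%:~R in fx *.
have {}xf : x < f + 1 by rewrite intrD in xf.
have -> : s1 = s0 + x * (2 * pi) by rewrite -xE; ring.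
by apply/andP; split; nra.
Qed.

(** * The Bezier average of two tangents of a circle *)

Lemma derive1_bezier_curve_half {R : realType} {n : nat}
    (x0 x1 : 'rV[R]_n * 'rV[R]_n) :
  derive1 (bezier_curve x0 x1) (1 / 2) =
  (3 / 2) *: (x1.1 - x0.1) -
  (3 / 4 * bezier_alpha x0 x1) *: (x0.2 + x1.2).
Proof.
set a := bezier_alpha x0 x1.
(* The cubic Bernstein polynomials; their derivatives at [1 / 2] are
   [-3/4, -3/4, 3/4, 3/4]. *)
pose f0 (t : R) := (1 - t) ^+ 3; pose f1 (t : R) := 3 * t * (1 - t) ^+ 2.
pose f2 (t : R) := 3 * t ^+ 2 * (1 - t); pose f3 (t : R) := t ^+ 3.
have d0 : is_derive (1 / 2 : R) 1 f0 (- (3 / 4)).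
  by apply: is_derive_eq; rewrite /GRing.scale /=; field.
have d1 : is_derive (1 / 2 : R) 1 f1 (- (3 / 4)).
  by apply: is_derive_eq; rewrite /GRing.scale /=; field.
have d2 : is_derive (1 / 2 : R) 1 f2 (3 / 4).
  by apply: is_derive_eq; rewrite /GRing.scale /=; field.
have d3 : is_derive (1 / 2 : R) 1 f3 (3 / 4).
  by apply: is_derive_eq; rewrite /GRing.scale /=; field.
have e0 := is_derive_scalev x0.1 d0.
have e1 := is_derive_scalev (x0.1 + a *: x0.2) d1.
have e2 := is_derive_scalev (x1.1 - a *: x1.2) d2.
have e3 := is_derive_scalev x1.1 d3.
rewrite derive1E.
have -> := @derive_val _ _ _ _ _ _ _
  (is_deriveD (is_deriveD (is_deriveD e0 e1) e2) e3).
by apply/rowP => i; rewrite !mxE; field.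
Qed.

Lemma circle_curveD {R : realType} {n : nat} (C : oriented_circle R n)
    (m h : R) :
  circle_curve C (m + h) = Defs.center C +
    Defs.radius C *: (cos h *: radial C m + sin h *: tangent C m).
Proof. by rewrite /circle_curve -/(radial C _) radialD. Qed.

Lemma circle_curveB {R : realType} {n : nat} (C : oriented_circle R n)
    (m h : R) :
  circle_curve C (m - h) = Defs.center C +
    Defs.radius C *: (cos h *: radial C m - sin h *: tangent C m).
Proof. by rewrite circle_curveD cosN sinN scaleNr. Qed.

Lemma tangentB {R : realType} {n : nat} (C : oriented_circle R n) (m h : R) :
  tangent C (m - h) = cos h *: tangent C m + sin h *: radial C m.
Proof. by rewrite tangentD cosN sinN scaleNr opprK. Qed.

Lemma circle_chord {R : realType} {n : nat} (C : oriented_circle R n)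
    (m h : R) :
  circle_curve C (m + h) - circle_curve C (m - h) =
  (2 * Defs.radius C * sin h) *: tangent C m.
Proof.
rewrite circle_curveD circle_curveB.
by apply/rowP => i; rewrite !mxE; ring.
Qed.

Lemma circle_chord_length_gt0 {R : realType} {n : nat}
    (C : oriented_circle R n) {h : R} :
  0 < h < pi -> 0 < 2 * Defs.radius C * sin h.
Proof.
by move=> h0; rewrite !mulr_gt0 ?radius_gt0 //; exact: sin_gt0_pi.
Qed.

Lemma dot_tangentD {R : realType} {n : nat} (C : oriented_circle R n)
    (m h : R) :
  dot (tangent C (m + h)) (tangent C m) = cos h.
Proof.
have [_ TT NT] := frame_orthonormal C m.
by rewrite tangentD -scaleNr dotDl !dotZl TT NT mulr0 addr0 mulr1.
Qed.

(** The chord points along the tangent at the midpoint of the arc, whatever the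
size of [h] in [(0, pi)], because [sin h > 0] there; and the tangents at the ends
are this direction turned by [-h] and [h].  So the arccosines are exactly [h],
even when the arc is longer than a half circle. *)
Lemma circle_chord_angles {R : realType} {n : nat} (C : oriented_circle R n)
    (m : R) {h : R} (h0 : 0 < h < pi) :
  let p0 := circle_curve C (m - h) in let p1 := circle_curve C (m + h) in
  chord_angle p0 p1 (tangent C (m - h)) = h /\
  chord_angle p0 p1 (tangent C (m + h)) = h.
Proof.
have [_ TT _] := frame_orthonormal C m.
rewrite /= /chord_angle circle_chord.
rewrite (normalizeZ_unit (circle_chord_length_gt0 C h0) TT) !dot_tangentD cosN.
by rewrite cosK // in_itv /=; lra.
Qed.

Lemma circle_bezier_admissible {R : realType} {n : nat}
    (C : oriented_circle R n) (m h : R) (h0 : 0 < h < pi) :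
  bezier_admissible (circle_curve C (m - h), tangent C (m - h))
                    (circle_curve C (m + h), tangent C (m + h)).
Proof.
have unit s : enorm (tangent C s) = 1.
  by have [_ TT _] := frame_orthonormal C s; rewrite /enorm TT sqrtr1.
have [a0 a1] := circle_chord_angles C m h0.
split; rewrite ?unit //=; last by rewrite a0 a1; lra.
move=> p01; have := circle_chord C m h.
rewrite p01 subrr => /esym/eqP; rewrite scaler_eq0.
rewrite gt_eqF ?circle_chord_length_gt0 //= => /eqP T0.
have [_ + _] := frame_orthonormal C m.
by rewrite T0 -(scale0r 0) dotZl mul0r => /esym/eqP; rewrite oner_eq0.
Qed.

(** The half angle [h] is written [q *+ 2], since the angle [(h + h) / 4] in the
definition of [alpha] is [q]; then [2 r sin h = 4 r sin q cos q], and one factor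
[cos q] cancels. *)
Lemma circle_bezier_alpha {R : realType} {n : nat}
    (C : oriented_circle R n) (m q : R) (q0 : 0 < q < pi / 2) :
  bezier_alpha (circle_curve C (m - q *+ 2), tangent C (m - q *+ 2))
               (circle_curve C (m + q *+ 2), tangent C (m + q *+ 2)) =
  4 / 3 * Defs.radius C * sin q / cos q.
Proof.
have h0 : 0 < q *+ 2 < pi by rewrite mulr2n; lra.
have cq : 0 < cos q by apply: cos_gt0_pihalf; lra.
have [_ TT _] := frame_orthonormal C m.
have [a0 a1] := circle_chord_angles C m h0.
rewrite /bezier_alpha a0 a1 circle_chord enormZ_unit ?circle_chord_length_gt0 //.
have -> : (q *+ 2 + q *+ 2) / 4 = q by field.
by rewrite sin_mulr2n; field; rewrite gt_eqF.
Qed.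

(** The handle length is exactly the one for which the height gained by the cubic
over its chord equals the height of the arc: both are [2 r sin^2 (h/2)]. *)
Lemma circle_bezier_average {R : realType} {n : nat}
    (C : oriented_circle R n) (m h : R) (h0 : 0 < h < pi) :
  bezier_average (1 / 2) (circle_curve C (m - h), tangent C (m - h))
                         (circle_curve C (m + h), tangent C (m + h)) =
  (circle_curve C m, tangent C m).
Proof.
have [q -> q0] : exists2 q, h = q *+ 2 & 0 < q < pi / 2.
  by exists (h / 2); [rewrite mulr2n; field | lra].
set x0 := (circle_curve C (m - _), _); set x1 := (circle_curve C (m + _), _).
have cq : 0 < cos q by apply: cos_gt0_pihalf; lra.
have sq : 0 < sin q by apply: sin_gt0_pihalf; lra.
have r0 := radius_gt0 C.
have [_ TT _] := frame_orthonormal C m.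
have alphaE : bezier_alpha x0 x1 = _ := circle_bezier_alpha C m q q0.
(* The speed of the cubic at the midpoint: [3 r sin h - (3/2) alpha cos h]. *)
pose l := 2 * Defs.radius C * sin q / cos q * (1 + cos q ^+ 2).
have l0 : 0 < l.
  by rewrite mulr_gt0 ?divr_gt0 ?mulr_gt0 // ltr_wpDr // sqr_ge0.
have b'E : derive1 (bezier_curve x0 x1) (1 / 2) = l *: tangent C m.
  rewrite derive1_bezier_curve_half alphaE /= circle_chord tangentB tangentD.
  rewrite sin_mulr2n cos_mulr2n.
  by apply/rowP => i; rewrite !mxE /l; field; rewrite gt_eqF.
have T0 : tangent C m != 0.
  apply/eqP => T0; move: TT; rewrite T0 -(scale0r 0) dotZl mul0r => /esym/eqP.
  by rewrite oner_eq0.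
rewrite /bezier_average b'E scaler_eq0 gt_eqF //= T0 normalizeZ_unit //.
congr pair; rewrite /bezier_curve alphaE /= circle_curveB circle_curveD.
rewrite tangentB tangentD sin_mulr2n cos_mulr2n /circle_curve -/(radial C m).
move: (radial C m) (tangent C m) => N T.
apply/rowP => i; rewrite ![in LHS]mxE.
(* Here [cos h] is [2 cos^2 q - 1] and the handles contribute [2 sin^2 q]. *)
transitivity (Defs.center C ord0 i +
    Defs.radius C * (2 * (cos q ^+ 2 + sin q ^+ 2) - 1) * N ord0 i).
  by field; rewrite gt_eqF.
by rewrite cos2Dsin2 !mxE; ring.
Qed.

Theorem lemma2p11 (R : realType) (n : nat) (hn : (2 <= n)%N)
    (C : oriented_circle R n) (p0 p1 v0 v1 : 'rV[R]_n)
    (hp0 : circle_points C p0) (hp1 : circle_points C p1) (hp : p0 <> p1)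
    (hv0 : circle_tangent C p0 v0) (hv1 : circle_tangent C p1 v1) :
  bezier_admissible (p0, v0) (p1, v1) /\
  exists m v : 'rV[R]_n,
    [/\ arc_midpoint C p0 p1 m, circle_tangent C m v &
        bezier_average (1 / 2) (p0, v0) (p1, v1) = (m, v)].
Proof.
case: hv0 => s0 []; rewrite normalize_derive1_circle_curve => p0E v0E.
case: hv1 => s []; rewrite normalize_derive1_circle_curve => p1E v1E.
have [k] := exists_turn_shift s0 s; set s1 := s + _ => /andP[s01 s1lt].
have [cE sE] := cos_sinDz s k.
have {}p1E : p1 = circle_curve C s1 by rewrite p1E /circle_curve cE sE.
have {}v1E : v1 = tangent C s1 by rewrite v1E /tangent cE sE.
have {}s01 : s0 < s1.
  rewrite lt_neqAle s01 andbT; apply/eqP => s01E.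
  by apply: hp; rewrite p0E p1E s01E.
pose m := (s0 + s1) / 2; pose h := (s1 - s0) / 2.
have h0 : 0 < h < pi by rewrite /h; lra.
have s0E : s0 = m - h by rewrite /m /h; field.
have s1E : s1 = m + h by rewrite /m /h; field.
rewrite p0E v0E p1E v1E s0E s1E; split; first exact: circle_bezier_admissible.
exists (circle_curve C m), (tangent C m); split.
- exists (m - h), m, (m + h); split => //; first by split => //; lra.
  + by lra.
  + by rewrite /arc_length; ring.
- by exists m; rewrite normalize_derive1_circle_curve.
- exact: circle_bezier_average.
Qed.
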